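(* Let $0 \le d \le n$ be integers and let $P \subset \mathbb{R}^n$ be a convex lattice polytope with $\dim P = d$. Then \[ \mathrm{SE}(P;z) = \mathrm{Ehr}(\mathrm{Pyr}\,P;z) = \frac{1}{1-z}\,\mathrm{Ehr}(P;z) = \frac{h^*(P;z)}{(1-z)^{d+2}}. \]
   Context: A convex lattice polytope in $\mathbb{R}^n$ is the convex hull of a nonempty finite subset of $\mathbb{Z}^n$. For a bounded convex set $S \subset \mathbb{R}^m$ and an integer $t \ge 0$, $\mathcal E(S;t) := \#(tS \cap \mathbb{Z}^m)$. For a convex lattice polytope $S$, $\mathrm{Ehr}(S;z) := \sum_{t=0}^\infty \mathcal E(S;t) z^t$. For $P$ of dimension $d$, $h^*(P;z) := (1-z)^{d+1}\mathrm{Ehr}(P;z)$. $\mathrm{Pyr}\,P \subset \mathbb{R}^{n+1}$ is the convex hull of $\{(v,0) : v \in V\} \cup \{(0,\dots,0,1)\}$, where $V \subset \mathbb{Z}^n$ is the vertex set of $P$. A horizontal giganture of $P$ is a polytope $G \subset \mathbb{R}^n$ such that $G = iP + a$ for some integer $i \ge 0$ and some $a \in \mathbb{Z}^n$ (for $i=0$ it is a single point). For an integer $t \ge 0$, $\mathcal H(P;t)$ is the number of horizontal gigantures of $P$ contained in $tP$. The summatory Ehrhart series of $P$ is $\mathrm{SE}(P;z) := \sum_{t=0}^\infty \mathcal H(P;t) z^t$.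
   Formalization: The equality SE(P;z) = Ehr(Pyr P;z) is stated only for d > 0, since for a point SE = 1/(1-z) but Ehr(Pyr P) = 1/(1-z)^2; for all d ≥ 0 it is given with gigantures counted as pairs (i,a), 0 ≤ i ≤ t. *)

(* Defs.v *)
From HB Require Import structures.
From mathcomp Require Import all_boot all_order all_algebra finmap.
From mathcomp Require Import all_classical all_reals all_analysis.

Set Implicit Arguments.
Unset Strict Implicit.
Unset Printing Implicit Defensive.

Import Order.TTheory GRing.Theory Num.Theory.
Local Open Scope classical_set_scope.
Local Open Scope ring_scope.

(* Formal power series: the ring structure is the Cauchy product, not the
   pointwise one that nat -> A already carries. *)
Record fps (A : comNzRingType) := Fps { fcoef : nat -> A }.

Section FpsRing.
Variable A : comNzRingType.
Implicit Types f g h : fps A.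

HB.instance Definition _ := gen_eqMixin (fps A).
HB.instance Definition _ := gen_choiceMixin (fps A).

Lemma fpsP f g : fcoef f =1 fcoef g <-> f = g.
Proof. by split=> [|->//]; case: f g => [f] [g] /= /funext ->. Qed.

Definition fps0 : fps A := Fps (fun=> 0).
Definition fps1 : fps A := Fps (fun n => (n == 0)%:R).
Definition fpsX : fps A := Fps (fun n => (n == 1)%:R).
Definition fps_opp f : fps A := Fps (fun n => - fcoef f n).
Definition fps_add f g : fps A := Fps (fun n => fcoef f n + fcoef g n).
Definition fps_mul f g : fps A :=
  Fps (fun n => \sum_(i < n.+1) fcoef f i * fcoef g (n - i)).

Fact fps_addA : associative fps_add.
Proof. by move=> f g h; apply/fpsP => n /=; rewrite addrA. Qed.
Fact fps_addC : commutative fps_add.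
Proof. by move=> f g; apply/fpsP => n /=; rewrite addrC. Qed.
Fact fps_add0 : left_id fps0 fps_add.
Proof. by move=> f; apply/fpsP => n /=; rewrite add0r. Qed.
Fact fps_addN : left_inverse fps0 fps_opp fps_add.
Proof. by move=> f; apply/fpsP => n /=; rewrite addNr. Qed.

HB.instance Definition _ :=
  GRing.isZmodule.Build (fps A) fps_addA fps_addC fps_add0 fps_addN.

Let trunc n f : {poly A} := \poly_(i < n.+1) fcoef f i.

Let coef_trunc n f i : (i <= n)%N -> (trunc n f)`_i = fcoef f i.
Proof. by move=> ilen; rewrite coef_poly ltnS ilen. Qed.

Let coef_truncM n f g m :
  (m <= n)%N -> (trunc n f * trunc n g)`_m = fcoef (fps_mul f g) m.
Proof.
move=> mn; rewrite coefM /=; apply: eq_bigr => i _.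
by rewrite !coef_trunc// (leq_trans _ mn)// ?leq_subr// -ltnS.
Qed.

Fact fps_mulC : commutative fps_mul.
Proof.
by move=> f g; apply/fpsP => n; rewrite -!(@coef_truncM n)// mulrC.
Qed.

Fact fps_mulA : associative fps_mul.
Proof.
move=> f g h; apply/fpsP => n.
transitivity ((trunc n f * (trunc n g * trunc n h))`_n).
  rewrite coefM /=; apply: eq_bigr => i _.
  by rewrite coef_truncM ?leq_subr// coef_trunc// -ltnS.
rewrite mulrA coefM /=; apply: eq_bigr => i _.
by rewrite coef_truncM ?coef_trunc ?leq_subr// -ltnS.
Qed.

Fact fps_mul1 : left_id fps1 fps_mul.
Proof.
move=> f; apply/fpsP => n /=.
rewrite big_ord_recl /= subn0 mul1r big1 ?addr0// => i _.
by rewrite mul0r.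
Qed.

Fact fps_mulDl : left_distributive fps_mul fps_add.
Proof.
move=> f g h; apply/fpsP => n /=; rewrite -big_split /=.
by apply: eq_bigr => i _; rewrite mulrDl.
Qed.

Fact fps_1neq0 : fps1 != 0.
Proof.
by apply/eqP => /fpsP /(_ 0%N) /= /eqP; rewrite oner_eq0.
Qed.

HB.instance Definition _ := GRing.Zmodule_isComNzRing.Build (fps A)
  fps_mulA fps_mulC fps_mul1 fps_mulDl fps_1neq0.

(* Inverses are chosen classically; a non-invertible series is its own
   inverse, as unitRingType requires. *)
Definition fps_unit : pred (fps A) := fun f => `[< exists g, g * f = 1 >].
Definition fps_inv f : fps A := xget f [set g | g * f = 1].

Fact fps_mulVr : {in fps_unit, left_inverse 1 fps_inv *%R}.
Proof.
by move=> f /asboolP [g gf]; rewrite /fps_inv; case: xgetP => [_ _ //|/(_ g)].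
Qed.

Fact fps_unitP f g : g * f = 1 -> fps_unit f.
Proof. by move=> gf; apply/asboolP; exists g. Qed.

Fact fps_inv_out : {in [predC fps_unit], fps_inv =1 id}.
Proof.
move=> f /asboolP nf; rewrite /fps_inv; case: xgetP => // g _ gf.
by case: nf; exists g.
Qed.

HB.instance Definition _ := GRing.ComNzRing_hasMulInverse.Build (fps A)
  fps_mulVr fps_unitP fps_inv_out.

Lemma fps_sub1X_unit : 1 - fpsX \is a GRing.unit.
Proof.
apply: (@fps_unitP _ (Fps (fun=> 1))); rewrite mulrC; apply/fpsP => -[|n] /=.
  by rewrite big_ord1 /= subr0 mulr1.
rewrite !big_ord_recl /= big1 => [|i _]; last by rewrite subrr mul0r.
by rewrite !mulr1 subr0 sub0r addr0 subrr.
Qed.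

End FpsRing.

(* The number of elements of a finite set; 0 on infinite sets. *)
Definition ncard (T : choiceType) (A : set T) : nat := #|` fset_set A|%fset.

Section Polytopes.
Variables (R : realType) (n : nat).
Implicit Types (S P G A : set 'rV[R]_n).

(* The lattice Z^n, embedded in R^n. *)
Definition lattice : set 'rV[R]_n := range (map_mx intr : 'rV[int]_n -> _).

Definition conv S : set 'rV[R]_n :=
  smallest [set C : set (convex_lmodType 'rV[R]_n) | convex_set C] S.

Definition lattice_polytope P : Prop :=
  exists V, [/\ finite_set V, V !=set0, V `<=` lattice & P = conv V].

Definition translate (x : 'rV[R]_n) S : set 'rV[R]_n := [set x + u | u in S].

Definition dilate (t : nat) S : set 'rV[R]_n := [set t%:R *: x | x in S].

Definition affine_hull S : set 'rV[R]_n :=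
  smallest
    [set A | exists x (U : {vspace 'rV[R]_n}), A = translate x [set` U]] S.

Definition has_dim S (d : nat) : Prop :=
  exists x (U : {vspace 'rV[R]_n}),
    affine_hull S = translate x [set` U] /\ \dim U = d.

(* Extreme points. *)
Definition vertices P : set 'rV[R]_n :=
  [set v | P v /\ forall x y (l : R), P x -> P y -> 0 < l < 1 ->
     v = l *: x + (1 - l) *: y -> x = v /\ y = v].

Definition lattice_count S (t : nat) : nat :=
  ncard (dilate t S `&` lattice).

Definition Ehr S : fps int := Fps (fun t => (lattice_count S t)%:Z).

(* Meaningful when has_dim P d. *)
Definition hstar (d : nat) P : fps int := (1 - fpsX int) ^+ d.+1 * Ehr P.

Definition homothet P (i : nat) (a : 'rV[R]_n) : set 'rV[R]_n :=
  translate a (dilate i P).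

Definition giganture P G : Prop :=
  exists i a, lattice a /\ G = homothet P i a.

(* Gigantures are counted as subsets of R^n. *)
Definition giganture_count P (t : nat) : nat :=
  ncard [set G | giganture P G /\ G `<=` dilate t P].

Definition SE P : fps int := Fps (fun t => (giganture_count P t)%:Z).

(* Gigantures of P in t P counted together with their size i and translation a,
   0 <= i <= t.  If P has positive dimension, the set i P + a determines (i, a)
   and i P + a `<=` t P forces i <= t, so this is giganture_count.  If P is a
   point, every i P + a is a point: giganture_count P t = 1 for all t, whereas
   here each size i = 0, ..., t contributes one giganture, for t + 1 in all. *)
Definition sized_giganture_count P (t : nat) : nat :=
  ncard [set ia : nat * 'rV[R]_n |
       [/\ (ia.1 <= t)%N, lattice ia.2 &
           homothet P ia.1 ia.2 `<=` dilate t P]].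

Definition sized_SE P : fps int :=
  Fps (fun t => (sized_giganture_count P t)%:Z).

End Polytopes.

(* row_mx v 0 is (v, 0), and the apex is (0, ..., 0, 1). *)
Definition Pyr (R : realType) (n : nat) (P : set 'rV[R]_n) :
    set 'rV[R]_(n + 1) :=
  conv ([set row_mx v 0 | v in vertices P] `|` [set row_mx 0 (const_mx 1)]).

(* Main.v *)
(** Write P as the set of all a *m A, with a a stochastic row vector and the rows
    of A the lattice points spanning P.  Both the lattice points of t Pyr P and the
    pairs (i, a) with i P + a in t P correspond to the pairs (i, a) with i <= t
    and a a lattice point of (t - i) P: for the pyramid i is the height of the
    layer, and for gigantures a set inclusion i P + a in i P + (t - i) P may be
    cancelled.  Summing over i gives the coefficients of Ehr(P) / (1 - z).
    If P is not a point, the set i P + a determines i by its width, then a by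
    cancellation. *)

Require Import Defs.
From mathcomp Require Import all_boot all_order all_algebra finmap.
From mathcomp Require Import all_classical all_reals all_analysis.
From mathcomp Require Import zify ring lra.

Set Implicit Arguments.
Unset Strict Implicit.
Unset Printing Implicit Defensive.

Import Order.TTheory GRing.Theory Num.Theory.
Local Open Scope classical_set_scope.
Local Open Scope ring_scope.

(* Plain conv is the operator of MathComp-Analysis convex spaces. *)
Local Notation conv := Defs.conv.

Lemma ncard_image (T T' : choiceType) (f : T -> T') (D : set T) :
  finite_set D -> {in D &, injective f} -> ncard (f @` D) = ncard D.
Proof.
move=> fD finj; rewrite /ncard fset_set_image//.
apply/eqP/card_in_imfsetP => x y; rewrite !in_fset_set//; exact: finj.
Qed.

(** * Stochastic row vectors and stationary vectors *)

Section Stochastic.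
Variable R : realFieldType.

Definition stoch m : set 'rV[R]_m :=
  [set a | (forall i, 0 <= a 0 i) /\ \sum_i a 0 i = 1].

(** The hull in matrix form: a family of hull points becomes a product [M *m A] with [M] stochastic,
    to which a stationary vector of [M] can be applied. It is empty for [m = 0], hence the
    hypotheses [0 < m] below. *)
Definition combos m n (A : 'M[R]_(m, n)) : set 'rV[R]_n :=
  [set a *m A | a in @stoch m].

Lemma stoch_delta m i : stoch (delta_mx 0 i : 'rV[R]_m).
Proof.
split=> [j|]; first by rewrite mxE ler0n.
rewrite (bigD1 i)//= big1 ?addr0 ?mxE ?eqxx// => j /negPf ji.
by rewrite mxE ji andbF.
Qed.

Lemma stoch_le1 m (a : 'rV[R]_m) i : stoch a -> a 0 i <= 1.
Proof.
move=> [a0 <-]; rewrite (bigD1 i)//= lerDl.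
by apply: sumr_ge0.
Qed.

Lemma stoch_eq_delta m (a : 'rV[R]_m) i :
  stoch a -> a 0 i = 1 -> a = delta_mx 0 i.
Proof.
move=> [a0 a1] ai.
have /psumr_eq0P az : \sum_(j | j != i) a 0 j = 0.
  by move: a1; rewrite (bigD1 i)//= ai => /(canRL (addKr _)); rewrite addNr.
apply/rowP => j; rewrite mxE /=.
by have [->//|ji] := eqVneq j i; rewrite az.
Qed.

Lemma stoch_convex m (a b : 'rV[R]_m) l :
  stoch a -> stoch b -> 0 <= l <= 1 -> stoch (l *: a + (1 - l) *: b).
Proof.
move=> [a0 a1] [b0 b1] /andP[l0 l1]; split=> [i|].
  by rewrite !mxE addr_ge0// mulr_ge0// subr_ge0.
under eq_bigr do rewrite !mxE.
by rewrite big_split /= -!mulr_sumr a1 b1; ring.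
Qed.

Lemma row_combos m n (A : 'M[R]_(m, n)) i : combos A (row i A).
Proof. by exists (delta_mx 0 i); [exact: stoch_delta|rewrite rowE]. Qed.

(* A left fixed vector u exists since M - 1 kills the all-ones column; the
   entrywise bound |u| <= |u| M is then an equality because both sides have
   the same sum, so |u| can be normalised. *)
Lemma stoch_stationary m (M : 'M[R]_m) : (0 < m)%N ->
  (forall i, stoch (row i M)) -> exists2 p, stoch p & p *m M = p.
Proof.
move=> m0 stM.
have M0 i j : 0 <= M i j by case: (stM i) => /(_ j); rewrite mxE.
have M1 i : \sum_j M i j = 1.
  by case: (stM i) => _ <-; apply: eq_bigr => j _; rewrite mxE.
have [u u0 uM] : exists2 u : 'rV_m, u != 0 & u *m (M - 1%:M) = 0.
  apply/det0P; rewrite -det_tr; apply/det0P; exists (const_mx 1).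
    apply/eqP => /rowP /(_ (Ordinal m0)); rewrite !mxE.
    by apply/eqP; rewrite oner_eq0.
  apply/rowP => i; rewrite !mxE.
  under eq_bigr do rewrite !mxE mul1r eq_sym.
  rewrite sumrB M1 (bigD1 i)//= big1 ?eqxx ?addr0 ?subrr// => j /negPf.
  by rewrite eq_sym => ->.
have uE j : u 0 j = \sum_i u 0 i * M i j.
  move/rowP: uM => /(_ j); rewrite mulmxBr mulmx1 !mxE => /eqP.
  by rewrite subr_eq0 => /eqP.
set s := \sum_i `|u 0 i|.
have s0 : 0 < s.
  have /cV0Pn[] : u^T != 0 by rewrite trmx_eq0.
  move=> i; rewrite mxE => ui; rewrite /s (bigD1 i)//= ltr_wpDr ?normr_gt0//.
  exact: sumr_ge0.
have fixM j : \sum_i `|u 0 i| * M i j = `|u 0 j|.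
  apply/eqP; rewrite -subr_eq0; apply/eqP; move: j (erefl true).
  apply: psumr_eq0P => [j _|].
    rewrite subr_ge0 [in leLHS]uE (le_trans (ler_norm_sum _ _ _))//.
    by apply: ler_sum => i _; rewrite normrM (ger0_norm (M0 _ _)).
  rewrite sumrB exchange_big /=; apply/eqP; rewrite subr_eq0; apply/eqP.
  by apply: eq_bigr => i _; rewrite -mulr_sumr M1 mulr1.
exists (\row_i (`|u 0 i| / s)).
  split=> [i|]; first by rewrite mxE divr_ge0// ltW.
  by under eq_bigr do rewrite mxE; rewrite -mulr_suml mulfV ?gt_eqF.
apply/rowP => j; rewrite !mxE.
under eq_bigr do rewrite mxE mulrAC.
by rewrite -mulr_suml fixM.
Qed.

End Stochastic.

(** * Convex hulls and their vertices *)

Section Convexity.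
Variables (R : realType) (n : nat).
Implicit Types (S P C : set 'rV[R]_n) (x y : 'rV[R]_n).

Definition is_convex C := forall x y l,
  C x -> C y -> 0 <= l <= 1 -> C (l *: x + (1 - l) *: y).

Lemma is_convexP C :
  is_convex C <-> convex_set (C : set (convex_lmodType 'rV[R]_n)).
Proof.
split=> [cC x y l /set_mem Cx /set_mem Cy|cC x y l Cx Cy /andP[l0 l1]].
  by apply/mem_set/cC => //; apply/andP; split.
apply: set_mem.
exact: (cC x y (Itv01 l0 l1) (mem_set Cx) (mem_set Cy)).
Qed.

Lemma sub_conv S : S `<=` conv S.
Proof. exact: sub_gen_smallest. Qed.

Lemma conv_convex S : is_convex (conv S).
Proof.
move=> x y l Sx Sy l01 C [/[dup] /is_convexP cC ? SC].
by apply: cC => //; [apply: Sx|apply: Sy].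
Qed.

Lemma conv_min S C : is_convex C -> S `<=` C -> conv S `<=` C.
Proof. by move=> /is_convexP ? ?; apply: smallest_sub. Qed.

(** Membership of [f i] is asked only for positive weights: in [combos_row'] the deleted row has
    weight 0 and is not known to lie in [C]. *)
Lemma is_convex_sum C I (r : seq I) (a : I -> R) (f : I -> 'rV[R]_n) :
  is_convex C -> (forall i, 0 <= a i) -> (forall i, 0 < a i -> C (f i)) ->
  \sum_(i <- r) a i = 1 -> C (\sum_(i <- r) a i *: f i).
Proof.
move=> cC a0 Cf a1.
(* Partial sums need not have total weight 1, so the induction carries their normalised value, or
   the vanishing of the sum while the weight is still 0. *)
suff [[/eqP]|[_]] : \sum_(i <- r) a i = 0 /\ \sum_(i <- r) a i *: f i = 0 \/
    0 < \sum_(i <- r) a i /\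
    C ((\sum_(i <- r) a i)^-1 *: \sum_(i <- r) a i *: f i).
- by rewrite a1 oner_eq0.
- by rewrite a1 invr1 scale1r.
elim: r {a1} => [|i r IH]; first by left; rewrite !big_nil.
rewrite !big_cons; have [ai|ai] := eqVneq (a i) 0.
  by rewrite ai scale0r !add0r.
have {}ai : 0 < a i by rewrite lt_neqAle eq_sym ai a0.
right; case: IH => [[-> ->]|[]].
  by rewrite !addr0 scalerA mulVf ?gt_eqF// scale1r; split=> //; apply: Cf.
set s := \sum_(j <- r) _ => s0 Cs; split; first exact: addr_gt0.
have as1 : 0 < a i + s by exact: addr_gt0.
have as0 : a i + s != 0 by rewrite gt_eqF.
have := cC _ _ (a i / (a i + s)) (Cf i ai) Cs.
have -> : 1 - a i / (a i + s) = s / (a i + s) by field.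
rewrite scalerA mulrAC mulfV ?gt_eqF// mul1r mulrC -scalerA -scalerDr; apply.
by rewrite mulr_ge0 ?invr_ge0 ?(ltW as1)//= ler_pdivrMl// mulr1 lerDl ltW.
Qed.

Lemma combos_convex m (A : 'M[R]_(m, n)) : is_convex (combos A).
Proof.
move=> _ _ l [a sa <-] [b sb <-] l01.
by exists (l *: a + (1 - l) *: b);
  [exact: stoch_convex|rewrite mulmxDl -!scalemxAl].
Qed.

Lemma combos_min m (A : 'M[R]_(m, n)) C :
  is_convex C -> (forall i, C (row i A)) -> combos A `<=` C.
Proof.
move=> cC CA _ [a [a0 a1] <-]; rewrite mulmx_sum_row.
exact: is_convex_sum.
Qed.

Lemma conv_rows m (A : 'M[R]_(m, n)) : conv (range (fun i => row i A)) = combos A.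
Proof.
apply/seteqP; split.
  by apply: conv_min; [exact: combos_convex|move=> _ [i _ <-]; exact: row_combos].
apply: combos_min; first exact: conv_convex.
by move=> i; apply: sub_conv; exists i.
Qed.

Lemma finite_set_rows S : finite_set S ->
  exists m (A : 'M[R]_(m, n)), S = range (fun i => row i A).
Proof.
move=> /finite_seqP[s ->]; exists (size s), (\matrix_i tnth (in_tuple s) i).
apply/seteqP; split=> [x /= /(tnthP (in_tuple s))[i ->]|_ [i _ <-] /=].
  by exists i => //; rewrite rowK.
by rewrite rowK mem_tnth.
Qed.

Lemma conv_nonempty_rows S : S !=set0 -> finite_set S ->
  exists m (A : 'M[R]_(m.+1, n)), S = range (fun i => row i A).
Proof.
move=> [x Sx] /finite_set_rows[[|m] [A SA]]; last by exists m, A.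
by move: Sx; rewrite SA => -[[]].
Qed.

(* If row i is a proper convex combination of other points of the hull, solving
   for it expresses it through the remaining rows. *)
Lemma combos_row' m (A : 'M[R]_(m.+1, n)) i :
  ~ vertices (combos A) (row i A) -> combos (row' i A) = combos A.
Proof.
move=> nv; have rowC j : j != i -> combos (row' i A) (row j A).
  rewrite eq_sym => /unlift_some[k -> _].
  by rewrite -row_rowsub; have := row_combos (row' i A) k.
apply/seteqP; split.
  apply: combos_min; first exact: combos_convex.
  by move=> j; rewrite row_rowsub; exact: row_combos.
apply: combos_min; first exact: combos_convex.
move=> j; have [->{j}|/rowC//] := eqVneq j i.
apply: contrapT => nC; apply: nv; split; first exact: row_combos.
move=> _ _ l [a sa <-] [b sb <-] l01 E.
set c := l *: a + (1 - l) *: b.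
have [l0 l1] := andP l01.
have sc : stoch c by apply: stoch_convex => //; rewrite !ltW.
have cE : row i A = c *m A by rewrite mulmxDl -!scalemxAl.
have ci1 : c 0 i = 1.
  apply/eqP/negPn/negP => ci; apply: nC.
  have {}ci : 0 < 1 - c 0 i.
    by rewrite subr_gt0 lt_neqAle ci stoch_le1.
  pose e j := if j == i then 0 else c 0 j / (1 - c 0 i).
  have -> : row i A = \sum_j e j *: row j A.
    apply: (@scalerI _ _ (1 - c 0 i)); first by rewrite gt_eqF.
    rewrite scalerBl scale1r {1}cE mulmx_sum_row (bigD1 i)//= addrC addrK.
    rewrite scaler_sumr [RHS](bigD1 i)//= /e eqxx scale0r scaler0 add0r.
    apply: eq_bigr => j /negPf ->.
    by rewrite scalerA mulrCA mulfV ?mulr1// gt_eqF.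
  have [c0 c1] := sc; apply: is_convex_sum.
  - exact: combos_convex.
  - by move=> j; rewrite /e; case: ifP => // _; rewrite divr_ge0// ltW.
  - by move=> j; rewrite /e; case: eqVneq => [_|ji _]; [rewrite ltxx|exact: rowC].
  - rewrite (bigD1 i)//= /e eqxx add0r.
    transitivity (\sum_(j | j != i) c 0 j / (1 - c 0 i)).
      by apply: eq_bigr => j /negPf ->.
    rewrite -mulr_suml (_ : \sum_(j | j != i) c 0 j = 1 - c 0 i).
      by rewrite mulfV// gt_eqF.
    by rewrite -c1 [in RHS](bigD1 i)//= addrAC subrr add0r.
(* A proper average of two numbers at most 1 equals 1 only if both do, so both points are row [i]
   itself. *)
have [ai1 bi1] : a 0 i = 1 /\ b 0 i = 1.
  have := stoch_le1 i sa; have := stoch_le1 i sb.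
  move: ci1; rewrite /c !mxE => ? ? ?; split; nra.
by rewrite (stoch_eq_delta sa ai1) (stoch_eq_delta sb bi1) -rowE.
Qed.

(** Rows that are not vertices are deleted one at a time without changing the hull, until every
    remaining row is a vertex. *)
Lemma combos_vertices m (A : 'M[R]_(m, n)) :
  combos A `<=` conv (vertices (combos A)).
Proof.
elim: m A => [|m IH] A.
  by move=> x [a [_]]; rewrite big_ord0 => /eqP; rewrite eq_sym oner_eq0.
have [vA|/existsNP[i /combos_row' <-]] :=
  pselect (forall i, vertices (combos A) (row i A)); last exact: IH.
apply: combos_min; first exact: conv_convex.
by move=> i; apply: sub_conv; exact: vA.
Qed.

Lemma conv_vertices m (A : 'M[R]_(m, n)) :
  conv (vertices (combos A)) = combos A.
Proof.
apply/seteqP; split; last exact: combos_vertices.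
by apply: conv_min; [exact: combos_convex|move=> x []].
Qed.

(** * Inclusions between homothets and cancellation *)

Lemma dilateP t P x : dilate t P x <-> exists2 y, P y & x = t%:R *: y.
Proof. by split=> [[y Py <-]|[y Py ->]]; exists y. Qed.

Lemma homothetP P i a x :
  homothet P i a x <-> exists2 y, P y & x = a + i%:R *: y.
Proof.
split=> [[_ [y Py <-] <-]|[y Py ->]]; first by exists y.
by exists (i%:R *: y) => //; exists y.
Qed.

(* Writing the rows of i A + a as t M A with M stochastic and multiplying by a
   stationary vector of M cancels i P from both sides. *)
Lemma homothet_sub_dilate m (A : 'M[R]_(m, n)) i t a : (0 < m)%N ->
  (i <= t)%N ->
  homothet (combos A) i a `<=` dilate t (combos A) <->
  dilate (t - i) (combos A) a.
Proof.
move=> m0 it; split=> [sub|].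
  have /choice[f fP] j : exists b, stoch b /\ a + i%:R *: row j A = t%:R *: (b *m A).
    have /sub [_ [b sb <-] <-] : homothet (combos A) i a (a + i%:R *: row j A).
      by apply/homothetP; exists (row j A) => //; exact: row_combos.
    by exists b.
  pose M := \matrix_j f j.
  have [j|p sp pM] := @stoch_stationary _ _ M m0; first by rewrite rowK; case: (fP j).
  exists (p *m A); first by exists p.
  have E : i%:R *: A + \matrix_(j < m) a = t%:R *: (M *m A).
    apply/row_matrixP => j; rewrite linearD !linearZ /= !rowK row_mul rowK addrC.
    by case: (fP j).
  have pa : p *m \matrix_(j < m) a = a.
    rewrite mulmx_sum_row; under eq_bigr do rewrite rowK.
    by rewrite -scaler_suml; case: sp => _ ->; rewrite scale1r.
  have := congr1 (mulmx p) E.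
  rewrite mulmxDr pa -!scalemxAr mulmxA pM.
  by rewrite natrB// scalerBl => <-; rewrite addrC addKr.
move=> /dilateP[y Py ->] _ /homothetP[x Px ->]; apply/dilateP.
(* The weight [i / t] used below requires [t] positive; if [t = 0] then [i = 0] too. *)
have [t0|t0] := posnP t.
  exists x => //; move: it; rewrite t0 leqn0 => /eqP ->.
  by rewrite !scale0r addr0.
exists ((i%:R / t%:R) *: x + (1 - i%:R / t%:R) *: y).
  apply: combos_convex => //; rewrite divr_ge0//=.
  by rewrite ler_pdivrMr ?ltr0n// mul1r ler_nat.
have t0' : t%:R != 0 :> R by rewrite pnatr_eq0 -lt0n.
rewrite scalerDr !scalerA mulrBr mulrCA mulfV// !mulr1.
by rewrite natrB// addrC.
Qed.

(** * Coordinate bounds: finiteness, and injectivity of homothets *)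

Lemma combos_le m (A : 'M[R]_(m, n)) k c x :
  (forall i, A i k <= c) -> combos A x -> x 0 k <= c.
Proof.
move=> Ac [a [a0 a1] <-]; rewrite mxE -[leRHS]mul1r -a1 mulr_suml.
by apply: ler_sum => i _; rewrite ler_wpM2l.
Qed.

Lemma combos_ge m (A : 'M[R]_(m, n)) k c x :
  (forall i, c <= A i k) -> combos A x -> c <= x 0 k.
Proof.
move=> Ac [a [a0 a1] <-]; rewrite mxE -[leLHS]mul1r -a1 mulr_suml.
by apply: ler_sum => i _; rewrite ler_wpM2l.
Qed.

Lemma combos_bounded m (A : 'M[R]_(m, n)) :
  exists N : nat, forall x k, combos A x -> `|x 0 k| <= N%:R.
Proof.
exists (\max_i \max_k Num.bound `|A i k|) => x k Px.
have AN i : `|A i k| <= (\max_i \max_k Num.bound `|A i k|)%:R.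
  apply: le_trans (ltW (archi_boundP (normr_ge0 _))) _; rewrite ler_nat.
  apply: leq_trans (leq_bigmax (F := fun i => \max_k Num.bound `|A i k|) i).
  exact: (leq_bigmax (F := fun k => Num.bound `|A i k|) k).
rewrite ler_norml (combos_le _ Px) ?(combos_ge _ Px)// => i.
  by have := AN i; rewrite ler_norml => /andP[].
by have := AN i; rewrite ler_norml => /andP[].
Qed.

Lemma finite_lattice_box (K : nat) :
  finite_set [set x : 'rV[R]_n | lattice x /\ forall k, `|x 0 k| <= K%:R].
Proof.
(* Integers from [-K] to [K] are indexed by an ordinal after a shift by [K]. *)
pose f (g : 'rV['I_(K + K).+1]_n) : 'rV[R]_n :=
  \row_k ((g 0 k)%:Z - K%:Z)%:~R.
apply: (@sub_finite_set _ _ [set f g | g in setT]); last first.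
  exact/finite_image/finite_finset.
move=> _ [[z _ <-] zK]; exists (\row_k inord `|(z 0 k + K%:Z)%R|%N) => //.
apply/rowP => k; rewrite !mxE; congr _%:~R.
have {zK} := zK k; rewrite mxE -intr_norm -[K%:R]/(K%:Z%:~R) ler_int => zK.
rewrite inordK; lia.
Qed.

Lemma finite_lattice_dilate m (A : 'M[R]_(m, n)) t :
  finite_set (dilate t (combos A) `&` @lattice R n).
Proof.
have [N PN] := combos_bounded A.
apply: sub_finite_set (finite_lattice_box (t * N)) => _ [[y Py <-] Ly].
split=> // k; rewrite mxE normrM normr_nat natrM ler_wpM2l//.
exact: PN.
Qed.

(* Compare the widths of both sides in a coordinate where the hull is not
   constant. *)
Lemma homothet_sub_size m (A : 'M[R]_(m, n)) i j a b x y :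
  combos A x -> combos A y -> x != y ->
  homothet (combos A) i a `<=` homothet (combos A) j b -> (i <= j)%N.
Proof.
case: m A => [|m] A Px Py.
  by case: Px => c [_]; rewrite big_ord0 => /eqP; rewrite eq_sym oner_eq0.
move=> /eqP xy sub; have [k xyk] : exists k, x 0 k != y 0 k.
  apply: contrapT => /forallNP xyE; apply: xy; apply/rowP => k.
  by apply/eqP/negPn/negP/xyE.
(* A coordinate attains its extrema over the hull at rows, so its width is the difference between
   rows [r] and [s]. *)
pose r := [arg max_(s > ord0) A s k]%O.
pose s := [arg min_(s < ord0) A s k]%O.
have Ar c : A c k <= A r k by rewrite /r; case: arg_maxP => // ? _; apply.
have As c : A s k <= A c k by rewrite /s; case: arg_minP => // ? _; apply.
have w0 : 0 < A r k - A s k.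
  rewrite subr_gt0 ltNge; apply: contra xyk => rs.
  have := combos_le Ar Px; have := combos_le Ar Py.
  have := combos_ge As Px; have := combos_ge As Py => ? ? ? ?.
  by apply/eqP; lra.
have /sub /homothetP[p Pp pE] : homothet (combos A) i a (a + i%:R *: row r A).
  by apply/homothetP; exists (row r A) => //; exact: row_combos.
have /sub /homothetP[q Pq qE] : homothet (combos A) i a (a + i%:R *: row s A).
  by apply/homothetP; exists (row s A) => //; exact: row_combos.
move/rowP: pE => /(_ k); move/rowP: qE => /(_ k); rewrite !mxE => qE pE.
rewrite -(ler_nat R) -(ler_pM2r w0).
apply: (@le_trans _ _ (j%:R * (p 0 k - q 0 k))); first by lra.
by rewrite ler_wpM2l// lerB// ?(combos_le Ar)// ?(combos_ge As).
Qed.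

(** The two inclusions give [i = j]; then [i P + (a - b)] lies in [i P], and cancellation puts
    [a - b] in [0 P], which is the origin. The distinct points [x] and [y] exclude a one-point hull,
    where the size cannot be recovered. *)
Lemma homothet_inj m (A : 'M[R]_(m, n)) i j a b x y :
  combos A x -> combos A y -> x != y ->
  homothet (combos A) i a = homothet (combos A) j b -> (i, a) = (j, b).
Proof.
move=> Px Py xy E.
have ij : i = j.
  by apply/eqP; rewrite eqn_leq (@homothet_sub_size _ A i j a b x y) ?E//
    (@homothet_sub_size _ A j i b a x y) ?E.
rewrite -{j}ij in E *; congr (_, _).
have m0 : (0 < m)%N.
  case: m A Px {Py E} => // A [c [_]].
  by rewrite big_ord0 => /eqP; rewrite eq_sym oner_eq0.
have : homothet (combos A) i (a - b) `<=` dilate i (combos A).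
  move=> _ /homothetP[z Pz ->].
  have /homothetP[w Pw wE] : homothet (combos A) i b (a + i%:R *: z).
    by rewrite -E; apply/homothetP; exists z.
  by exists w => //; rewrite addrAC wE addrAC subrr add0r.
rewrite homothet_sub_dilate// subnn => -[z _].
by rewrite scale0r => /esym/eqP; rewrite subr_eq0 => /eqP.
Qed.

(** * Counting pairs of a size and a translation *)

Definition sized_translations P t : set (nat * 'rV[R]_n) :=
  [set ia | (ia.1 <= t)%N /\ (dilate (t - ia.1) P `&` @lattice R n) ia.2].

Lemma sized_translationsE P t : sized_translations P t =
  \bigcup_(i < t.+1) [set (i, a) | a in dilate (t - i) P `&` @lattice R n].
Proof.
apply/seteqP; split=> [[i a] /= [it La]|_ [i /= it [a La <-]]].
  by exists i => //; exists a.
by split.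
Qed.

Lemma finite_sized_translations P t :
  (forall k, finite_set (dilate k P `&` @lattice R n)) ->
  finite_set (sized_translations P t).
Proof.
move=> fP; rewrite sized_translationsE; apply: bigcup_finite => // i _.
exact: finite_image.
Qed.

Lemma ncard_sized_translations P t :
  (forall k, finite_set (dilate k P `&` @lattice R n)) ->
  ncard (sized_translations P t) = (\sum_(i < t.+1) lattice_count P (t - i))%N.
Proof.
move=> fP; rewrite sized_translationsE bigcup_mkord /ncard -(trivIset_sum_card (F :=
  fun i => [set (i, a) | a in dilate (t - i) P `&` @lattice R n])).
- apply: eq_bigr => i _; rewrite [LHS]ncard_image// => a b _ _ [] //.
- by move=> i; exact: finite_image.
- by move=> i j _ _ [_ [[a _ <-] [b _ [->]]]].
Qed.

End Convexity.

(** * The pyramid and its lattice points, layer by layer *)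

Section Pyramid.
Variables (R : realType) (n : nat).
Implicit Types (P : set 'rV[R]_n) (x : 'rV[R]_n).

(** The pyramid described by its slices: at height [s] it is [(1 - s) P]. *)
Definition cone P : set 'rV[R]_(n + 1) :=
  [set z | exists x s, [/\ P x, 0 <= s <= 1 &
                         z = row_mx ((1 - s) *: x) (const_mx s)]].

Lemma cone_convex P : is_convex P -> is_convex (cone P).
Proof.
move=> cP _ _ l [x [s [Px /andP[s0 s1] ->]]] [y [r [Py /andP[r0 r1] ->]]].
move=> /andP[l0 l1]; rewrite !scale_row_mx add_row_mx.
set q := l * s + (1 - l) * r.
have q0 : 0 <= q by rewrite addr_ge0// mulr_ge0// subr_ge0.
have qE : 1 - q = l * (1 - s) + (1 - l) * (1 - r) by rewrite /q; ring.
have ls0 : 0 <= l * (1 - s) by rewrite mulr_ge0// subr_ge0.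
have lr0 : 0 <= (1 - l) * (1 - r) by rewrite mulr_ge0// subr_ge0.
have q1 : 0 <= 1 - q by rewrite qE addr_ge0.
have cE : l *: const_mx s + (1 - l) *: const_mx r = const_mx q :> 'rV_1.
  by apply/rowP => i; rewrite !mxE.
(* At height [q = 1] the point is the apex: both base weights vanish and any base point serves.
   Otherwise the base weights are renormalised by [1 - q]. *)
rewrite cE !scalerA; have [qz|qz] := eqVneq (1 - q) 0.
  exists x, q; split=> //; first by rewrite q0 -subr_ge0.
  have -> : l * (1 - s) = 0 by lra.
  have -> : (1 - l) * (1 - r) = 0 by lra.
  by rewrite qz !scale0r addr0.
pose k := l * (1 - s) / (1 - q).
exists (k *: x + (1 - k) *: y), q; split; last 2 first.
- by rewrite q0 -subr_ge0.
- congr row_mx; rewrite scalerDr !scalerA; congr (_ *: _ + _ *: _).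
    by rewrite [_ * k]mulrC divfK.
  by rewrite [RHS]mulrBr mulr1 [_ * k]mulrC divfK// {1}qE addrAC subrr add0r.
- apply: cP => //; rewrite /k divr_ge0//= ler_pdivrMr ?mul1r ?qE ?lerDl//.
  by rewrite -qE lt_neqAle eq_sym qz.
Qed.

Lemma Pyr_cone m (A : 'M[R]_(m, n)) : (0 < m)%N ->
  Pyr (combos A) = cone (combos A).
Proof.
move=> m0; apply/seteqP; split.
  apply: conv_min; first exact/cone_convex/combos_convex.
  move=> _ [[v [Pv _] <-]|->].
    exists v, 0; rewrite lexx ler01 subr0 scale1r; split=> //.
  exists (row (Ordinal m0) A), 1; rewrite lexx ler01 subrr scale0r; split=> //.
  exact: row_combos.
rewrite /Pyr; set G := _ `|` _.
(* The generators contain only the vertices of the base. The [y] with [(y, 0)] in the hull form a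
   convex set containing these vertices, hence all of [P]. *)
have base x : combos A x -> conv G (row_mx x 0).
  rewrite -conv_vertices.
  apply: (@conv_min _ _ _ [set y | conv G (row_mx y 0)]) => [y z l|v vA].
    move=> Gy Gz l01; have := conv_convex Gy Gz l01.
    by rewrite /= !scale_row_mx add_row_mx !scaler0 addr0.
  by apply: sub_conv; left; exists v.
move=> _ [x [s [/base Gx s01 ->]]].
have Gapex : conv G (row_mx 0 (const_mx 1)) by apply: sub_conv; right.
have := conv_convex Gapex Gx s01.
rewrite !scale_row_mx add_row_mx !scaler0 add0r addr0.
by have -> : s *: const_mx 1 = const_mx s :> 'rV_1
  by apply/rowP => i; rewrite !mxE mulr1.
Qed.

Definition layer (ia : nat * 'rV[R]_n) : 'rV[R]_(n + 1) :=
  row_mx ia.2 (const_mx ia.1%:R).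

Lemma layer_inj : injective layer.
Proof.
move=> [i a] [j b] /eq_row_mx[/= -> /rowP/(_ 0)]; rewrite !mxE => /eqP.
by rewrite eqr_nat => /eqP ->.
Qed.

Lemma lattice_row_mx x (s : R) :
  lattice (row_mx x (const_mx s : 'rV_1)) <->
  lattice x /\ exists z : int, s = z%:~R.
Proof.
split=> [[w _]|[[v _ <-] [z ->]]]; last first.
  exists (row_mx v (const_mx z)) => //; rewrite map_row_mx map_const_mx//.
rewrite -[w]hsubmxK map_row_mx => /eq_row_mx[<- /rowP/(_ 0)].
by rewrite !mxE => <-; split; [exists (lsubmx w)|eexists].
Qed.

Lemma lattice_Pyr m (A : 'M[R]_(m, n)) t : (0 < m)%N ->
  dilate t (Pyr (combos A)) `&` @lattice R (n + 1) =
  layer @` sized_translations (combos A) t.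
Proof.
move=> m0; rewrite Pyr_cone//; apply/seteqP; split.
  move=> _ [/dilateP[_ [x [s [Px /andP[s0 s1] ->]] ->]]].
  have tsE : t%:R *: const_mx s = const_mx (t%:R * s) :> 'rV_1.
    by apply/rowP => k; rewrite !mxE.
  rewrite scale_row_mx scalerA tsE => /lattice_row_mx[Lx [z zE]].
  have z0 : 0 <= z by rewrite -(ler0z R) -zE mulr_ge0.
  (* The height [t s] is an integer [i] between 0 and [t], and the base part [t (1 - s) x] is then
     [(t - i) x]. *)
  case: z z0 zE => // i _ zE; rewrite -[_%:~R]/(i%:R) in zE.
  have it : (i <= t)%N by rewrite -(ler_nat R) -zE ler_piMr.
  exists (i, (t%:R * (1 - s)) *: x); last by rewrite /layer /= zE.
  split=> //; split=> //; exists x => //.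
  by rewrite /= natrB// mulrBr mulr1 zE.
move=> _ [[i a] [it [Da La]] <-]; move: it Da La => /=.
move=> it /dilateP[x Px ->] La; split; last first.
  by apply/lattice_row_mx; split; [exact: La|exists i].
apply/dilateP; have [t0|t0] := posnP t.
  exists (row_mx x (const_mx 0)); last first.
    move: it; rewrite t0 leqn0 => /eqP ->; rewrite /layer /= !scale0r.
    exact: row_mx0.
  by exists x, 0; rewrite lexx ler01 subr0 scale1r.
have t0' : t%:R != 0 :> R by rewrite pnatr_eq0 -lt0n.
exists (row_mx ((1 - i%:R / t%:R) *: x) (const_mx (i%:R / t%:R))).
  exists x, (i%:R / t%:R); split=> //; rewrite divr_ge0//=.
  by rewrite ler_pdivrMr ?ltr0n// mul1r ler_nat.
rewrite scale_row_mx scalerA /layer /= natrB//; congr row_mx.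
  by rewrite mulrBr mulr1 mulrCA mulfV// mulr1.
by apply/rowP => k; rewrite !mxE mulrCA mulfV// mulr1.
Qed.

End Pyramid.

(** * Power series and the final identities *)

Lemma fps_div_sub1X (A : comNzRingType) (f : fps A) :
  1 / (1 - fpsX A) * f = Fps (fun t => \sum_(i < t.+1) fcoef f (t - i)).
Proof.
(* The inverse is chosen classically, so it is identified by cancelling the unit [1 - X];
   multiplication by the all-ones series takes partial sums. *)
have -> : 1 / (1 - fpsX A) = Fps (fun=> 1).
  apply: (mulIr (fps_sub1X_unit A)); rewrite divrK ?fps_sub1X_unit//.
  rewrite mulrC; apply/fpsP => -[|t] /=; first by rewrite big_ord1 /= subr0 mulr1.
  rewrite !big_ord_recl /= big1 => [|i _]; last by rewrite subrr mul0r.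
  by rewrite !mulr1 subr0 sub0r addr0 subrr.
by apply/fpsP => t /=; apply: eq_bigr => i _; rewrite mul1r.
Qed.

(** Otherwise [P] lies in the affine subspace [[set x]], so its affine hull does too, and the
    direction [U] is zero. *)
Lemma has_dim_gt0 (R : realType) n (P : set 'rV[R]_n) d x :
  P x -> has_dim P d -> (0 < d)%N -> exists2 y, P y & y != x.
Proof.
move=> Px [y [U [PU <-]]]; rewrite lt0n dimv_eq0 => U0.
apply: contrapT => nP; move: U0; apply/negP/negPn.
have : translate y [set` U] `<=` [set x].
  rewrite -PU; apply: smallest_sub.
    exists x, 0%VS; apply/seteqP; split=> [_ ->|_ [u /= + <-]].
      by exists 0; rewrite /= ?mem0v ?addr0.
    by rewrite memv0 => /eqP ->; rewrite addr0.
  move=> z Pz; apply/eqP/negPn/negP => zx; apply: nP; by exists z.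
move=> sub; rewrite -subv0; apply/subvP => u uU; rewrite memv0.
have ux : y + u = x by apply: sub; exists u.
have yx : y + 0 = x by apply: sub; exists 0 => //=; rewrite mem0v.
by move: ux; rewrite -yx => /addrI ->.
Qed.

(** For [d = 0] the only giganture in [t P] is the point [t P], so [SE P] is [1 / (1 - z)] while the
    pyramid, a segment, has series [1 / (1 - z)^2]. Hence the first equality assumes [0 < d], and
    the second, valid in every dimension, counts sizes separately. *)
Theorem theorem4 (R : realType) (d n : nat) (hdn : (d <= n)%N)
    (P : set 'rV[R]_n) (hP : lattice_polytope P) (hd : has_dim P d) :
  [/\ (0 < d)%N -> SE P = Ehr (Pyr P),
      sized_SE P = Ehr (Pyr P),
      Ehr (Pyr P) = 1 / (1 - fpsX int) * Ehr P &
      1 / (1 - fpsX int) * Ehr P = hstar d P / (1 - fpsX int) ^+ d.+2].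
Proof.
case: hP hd => V [finV V0 _ ->].
have [m [A ->]] := conv_nonempty_rows V0 finV.
rewrite conv_rows => {V finV V0 P hdn} hd; set P := combos A.
have finT t : finite_set (sized_translations P t).
  by apply: finite_sized_translations => k; exact: finite_lattice_dilate.
have sizedE t : [set ia : nat * 'rV[R]_n | [/\ (ia.1 <= t)%N, lattice ia.2 &
    homothet P ia.1 ia.2 `<=` dilate t P]] = sized_translations P t.
  apply/seteqP; split=> [[i a] [/= it La] /homothet_sub_dilate H|].
    by split=> //; split=> //; exact: H.
  by move=> [i a] [/= it [Da La]]; split=> //; apply/homothet_sub_dilate.
have PyrE t : lattice_count (Pyr P) t = ncard (sized_translations P t).
  rewrite /lattice_count lattice_Pyr// ncard_image// => ? ? _ _.
  exact: layer_inj.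
split.
- move=> d0; apply/fpsP => t /=; congr Posz; rewrite PyrE.
  have Px := row_combos A ord0.
  have [y Py yx] := has_dim_gt0 Px hd d0.
  rewrite -(@ncard_image _ _ (fun ia => homothet P ia.1 ia.2))//; last first.
    by move=> [i a] [j b] _ _; exact: homothet_inj Py Px yx.
  rewrite -sizedE; congr ncard; apply/seteqP; split.
    move=> _ [[i [a [La ->]]] sub]; exists (i, a) => //; split=> //.
    (* A giganture carries no bound on its size; [i <= t] follows by comparing widths with [t P],
       seen as the homothet [t P + 0]. *)
    apply: (homothet_sub_size (b := 0) Py Px yx) => z /sub [w Pw <-].
    by apply/homothetP; exists w; rewrite ?add0r.
  by move=> _ [[i a] [/= _ La sub] <-]; split=> //; exists i, a.
- by apply/fpsP => t /=; rewrite PyrE /sized_giganture_count sizedE.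
- rewrite fps_div_sub1X; apply/fpsP => t /=.
  rewrite PyrE ncard_sized_translations => [|k]; last exact: finite_lattice_dilate.
  by rewrite -[LHS]natz natr_sum; apply: eq_bigr => i _; rewrite natz.
- have U := fps_sub1X_unit int.
  (* After clearing the denominator, one factor cancels [1 / (1 - X)] and the other [d + 1] are
     those of [hstar]. *)
  apply: (mulIr (unitrX d.+2 U)); rewrite divrK ?unitrX// /hstar mul1r.
  by rewrite exprS mulrAC mulrA mulVr// mul1r.
Qed.
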